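(* There exists a randomized algorithm which, given cut-query oracle access to an unweighted, undirected simple graph $G=(V,E)$ on $n$ vertices, makes $\widetilde{O}(n)$ queries and with high probability outputs an exact global minimum cut of $G$.
   Context: A cut query takes a set $S\subseteq V$ and returns $c(S)$, the number of edges of $G$ with exactly one endpoint in $S$. A global minimum cut is a set $S$ with $\emptyset\neq S\subsetneq V$ minimizing $c(S)$. $\widetilde{O}(x)$ denotes $O(x\cdot \mathrm{polylog}(x))$. ''With high probability'' means with probability at least $1-n^{-\Omega(1)}$. *)

(* Defs.v *)
From Stdlib Require Import Reals.
From mathcomp Require Import all_boot.

Set Implicit Arguments.
Unset Strict Implicit.
Unset Printing Implicit Defensive.

Definition simple_graph (n : nat) (g : rel 'I_n) : Prop :=
  symmetric g /\ irreflexive g.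

(* c(S): number of edges with exactly one endpoint in S.  Each such edge
   {u,v} (u in S, v not in S) is counted once, as the ordered pair (u,v). *)
Definition cut_value (n : nat) (g : rel 'I_n) (S : {set 'I_n}) : nat :=
  #|[set e : 'I_n * 'I_n | [&& g e.1 e.2, e.1 \in S & e.2 \notin S]]|.

Definition is_global_min_cut (n : nat) (g : rel 'I_n) (S : {set 'I_n}) : bool :=
  [&& S != set0, S != setT &
      [forall T : {set 'I_n},
          ((T != set0) && (T != setT)) ==> (cut_value g S <= cut_value g T)]].

(* Deterministic adaptive cut-query algorithms on n vertices (decision trees):
   either output a set, or ask a cut query S and continue depending on the
   answer c(S). *)
Inductive qtree (n : nat) : Type :=
| QLeaf of {set 'I_n}
| QAsk of {set 'I_n} & (nat -> qtree n).

Fixpoint run (n : nat) (oracle : {set 'I_n} -> nat) (t : qtree n)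
  : {set 'I_n} * nat :=
  match t with
  | QLeaf X => (X, 0)
  | QAsk X k => let r := run oracle (k (oracle X)) in (r.1, r.2.+1)
  end.

(* A randomized algorithm on n vertices using m random bits is a map from
   seeds {ffun 'I_m -> bool} (uniformly distributed) to query trees. *)
Definition failure_prob (n m : nat) (A : {ffun 'I_m -> bool} -> qtree n)
  (g : rel 'I_n) : R :=
  Rdiv (INR #|[set w : {ffun 'I_m -> bool} |
                 ~~ is_global_min_cut g (run (cut_value g) (A w)).1]|)
       (INR #|{ffun 'I_m -> bool}|).

(* Main.v *)
(* Let D be the minimum degree.  Singletons are cuts of value at least D, so
   assume that a minimum cut S has value less than D.

   Contraction.  Sample each vertex with probability 1/M, M ~ D / log n, and let
   every vertex v join a uniformly random sampled neighbour.  There are about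
   n/M classes.  Moving a vertex across S does not improve it, so v has at least
   D/2 neighbours on its own side, of which at least theta ~ log n are sampled
   (Chernoff).  Given the sample, S survives with probability
   prod_v 1 / (1 + c_v / s_v), where c_v and s_v count the sampled neighbours
   of v on the other side and on its own.  As s_v >= theta, and sum_v c_v has
   expectation 2 c(S) / M = O(theta), this is bounded below by a constant.

   Search.  Keep the set H of edges found so far, and let T be a lightest cut of
   H among the unions of classes.  If H contains all the edges across T, then T
   is a minimum cut of the contracted graph; otherwise binary search finds a new
   edge across T.  As long as T has fewer than D edges of H, this happens at most
   D times per class, that is O~(D * n/M) = O~(n) times in all.

   Repeating O(log n) times makes the failure probability at most 1/n. *)

Require Import Defs.
From Stdlib Require Import Reals Lra.
From mathcomp Require Import all_boot.
From mathcomp Require Import zify.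

Set Implicit Arguments.
Unset Strict Implicit.
Unset Printing Implicit Defensive.

(** * Elementary estimates *)

(** Bernoulli's inequality [1 + c/b <= (1 + 1/a) ^ c] with denominators cleared. Later [b] and [c]
    count the sampled neighbours of a vertex on its own side and across. *)
Lemma expn_bernoulli (a b c : nat) : a <= b -> (b + c) * a ^ c <= b * a.+1 ^ c.
Proof.
move=> ab; elim: c => [|c IH]; first by rewrite addn0.
rewrite !expnS.
have {}IH : a.+1 * ((b + c) * a ^ c) <= a.+1 * (b * a.+1 ^ c) by rewrite leq_mul2l IH orbT.
have H : (b + c.+1) * a <= a.+1 * (b + c) by nia.
have : (b + c.+1) * a * a ^ c <= a.+1 * (b + c) * a ^ c by rewrite leq_mul2r H orbT.
by nia.
Qed.

Lemma expn_bernoulli_sub (a c : nat) : (a.+1 - c) * a.+1 ^ c <= a.+1 * a ^ c.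
Proof.
elim: c => [|c IH]; first by rewrite subn0.
rewrite !expnS.
have {}IH : a * ((a.+1 - c) * a.+1 ^ c) <= a * (a.+1 * a ^ c) by rewrite leq_mul2l IH orbT.
have H : (a.+1 - c.+1) * a.+1 <= a * (a.+1 - c) by nia.
have : (a.+1 - c.+1) * a.+1 * a.+1 ^ c <= a * (a.+1 - c) * a.+1 ^ c.
  by rewrite leq_mul2r H orbT.
by nia.
Qed.

Lemma expnS_le_double (a c : nat) : 2 * c <= a.+1 -> a.+1 ^ c <= 2 * a ^ c.
Proof.
move=> ca; rewrite -(@leq_pmul2l a.+1) //.
have H := expn_bernoulli_sub a c.
have : a.+1 * a.+1 ^ c <= 2 * (a.+1 - c) * a.+1 ^ c by rewrite leq_mul2r; apply/orP; right; lia.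
by nia.
Qed.

(** Split the exponent into at most [N] blocks of length at most [h]; each costs a factor 2. *)
Lemma expnS_le_expn2 (a h N c : nat) :
  2 * h <= a.+1 -> c <= N * h -> a.+1 ^ c <= 2 ^ N * a ^ c.
Proof.
move=> ha; elim: N c => [|N IH] c cN.
  by have -> : c = 0 by lia.
have E : c = minn c h + (c - h) by lia.
rewrite {1 2}E !expnD expnS.
have H1 : a.+1 ^ minn c h <= 2 * a ^ minn c h by apply: expnS_le_double; lia.
have H2 : a.+1 ^ (c - h) <= 2 ^ N * a ^ (c - h) by apply: IH; lia.
have := leq_mul H1 H2; lia.
Qed.

Lemma expn_pred_le_half (k : nat) : 0 < k -> 2 * k.-1 ^ k <= k ^ k.
Proof.
case: k => [//|[|k]] _ //.
have H := @expn_bernoulli k.+1 k.+1 k.+2 (leqnn _).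
rewrite -(@leq_pmul2l k.+1) //=; apply: leq_trans H.
by rewrite mulnA leq_mul2r; apply/orP; right; lia.
Qed.

Lemma expn_pred_decay (k s c : nat) :
  0 < k -> k * s <= c -> 2 ^ s * k.-1 ^ c <= k ^ c.
Proof.
move=> k0 ksc; rewrite -(subnKC ksc) !expnD !expnM mulnA -expnMn.
apply: leq_mul; first by case: s {ksc} => // s; rewrite leq_exp2r // expn_pred_le_half.
by case: (c - _) => // e; rewrite leq_exp2r // leq_pred.
Qed.

(** * Query programs and edge counts *)

(** Unlike [qtree], these return values of any type, so that subroutines compose. *)
Inductive prog (n : nat) (X : Type) : Type :=
| Ret of X
| Ask of {set 'I_n} & (nat -> prog n X).
Arguments Ret {n X} _.
Arguments Ask {n X} _ _.

Fixpoint bind n X Y (p : prog n X) (f : X -> prog n Y) : prog n Y :=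
  match p with
  | Ret x => f x
  | Ask Q k => Ask Q (fun a => bind (k a) f)
  end.

Notation "x <-- p ; q" := (bind p (fun x => q))
  (at level 61, p at next level, q at level 200, right associativity).

Fixpoint value n X (o : {set 'I_n} -> nat) (p : prog n X) : X :=
  match p with
  | Ret x => x
  | Ask Q k => value o (k (o Q))
  end.

Fixpoint cost n X (o : {set 'I_n} -> nat) (p : prog n X) : nat :=
  match p with
  | Ret _ => 0
  | Ask Q k => (cost o (k (o Q))).+1
  end.

Fixpoint qtree_of n (p : prog n {set 'I_n}) : qtree n :=
  match p with
  | Ret Q => QLeaf Q
  | Ask Q k => QAsk Q (fun a => qtree_of (k a))
  end.

Definition ask n (S : {set 'I_n}) : prog n nat := Ask S Ret.

Lemma run_qtree_of n o (p : prog n {set 'I_n}) :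
  run o (qtree_of p) = (value o p, cost o p).
Proof. by elim: p => //= S k IH; rewrite IH. Qed.

Lemma value_bind n X Y o (p : prog n X) (f : X -> prog n Y) :
  value o (bind p f) = value o (f (value o p)).
Proof. by elim: p => //= S k IH; rewrite IH. Qed.

Lemma cost_bind n X Y o (p : prog n X) (f : X -> prog n Y) :
  cost o (bind p f) = cost o p + cost o (f (value o p)).
Proof. by elim: p => //= S k IH; rewrite IH. Qed.

(** Storing all answers makes later uses of the resulting function free of queries. *)
Fixpoint tabulate n X (f0 : 'I_n -> X) (f : 'I_n -> prog n X) (s : seq 'I_n) :
    prog n ('I_n -> X) :=
  if s is v :: s' then
    y <-- f v; h <-- tabulate f0 f s'; Ret (fun u => if u == v then y else h u)
  else Ret f0.

Lemma value_tabulate n X o f0 (f : 'I_n -> prog n X) s u :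
  u \in s -> value o (tabulate f0 f s) u = value o (f u).
Proof.
elim: s => //= v s IH; rewrite inE !value_bind /=.
by case: eqP => [->|_] //=; apply: IH.
Qed.

Lemma cost_tabulate n X o f0 (f : 'I_n -> prog n X) s c :
  (forall u, cost o (f u) <= c) -> cost o (tabulate f0 f s) <= size s * c.
Proof.
move=> H; elim: s => //= v s IH; rewrite !cost_bind /= addn0 mulSn.
exact: leq_add.
Qed.

Definition edges n (g : rel 'I_n) (A B : {set 'I_n}) : nat :=
  \sum_(v in B) \sum_(u in A) g u v.

Section Edges.
Variable n : nat.
Implicit Types (g : rel 'I_n) (A B S : {set 'I_n}).

Lemma cut_valueE g S : cut_value g S = edges g S (~: S).
Proof.
rewrite /cut_value /edges -sum1_card exchange_big /= pair_big_dep /=.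
under eq_bigl => e do rewrite inE.
rewrite [LHS]big_mkcond [RHS]big_mkcond; apply: eq_bigr => -[u v] _ /=.
by rewrite inE; case: (g u v); case: (u \in S); case: (v \in S).
Qed.

Lemma edges_sym g A B : symmetric g -> edges g A B = edges g B A.
Proof.
move=> gs; rewrite /edges exchange_big /=.
by apply: eq_bigr => u _; apply: eq_bigr => v _; rewrite gs.
Qed.

Lemma edgesUr g A B1 B2 : [disjoint B1 & B2] ->
  edges g A (B1 :|: B2) = edges g A B1 + edges g A B2.
Proof. by move=> d; rewrite /edges (eq_bigl [predU B1 & B2]) ?bigU //= => u; rewrite !inE. Qed.

Lemma edgesUl g A1 A2 B : [disjoint A1 & A2] ->
  edges g (A1 :|: A2) B = edges g A1 B + edges g A2 B.
Proof.
move=> d; rewrite /edges -big_split /=.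
apply: eq_bigr => v _; rewrite (eq_bigl [predU A1 & A2]) ?bigU //= => u.
by rewrite !inE.
Qed.

Lemma edges_subrel g1 g2 A B : subrel g1 g2 -> edges g1 A B <= edges g2 A B.
Proof.
move=> sg; apply: leq_sum => v _; apply: leq_sum => u _.
by case E: (g1 u v) => //; rewrite sg.
Qed.

Lemma edges_diff g h A B : subrel h g ->
  edges (fun u v => g u v && ~~ h u v) A B = edges g A B - edges h A B.
Proof.
move=> sg; apply/eqP; rewrite -(eqn_add2r (edges h A B)) subnK ?edges_subrel //.
rewrite /edges -big_split /=; apply/eqP; apply: eq_bigr => v _.
rewrite -big_split /=; apply: eq_bigr => u _.
by case E: (h u v); [rewrite (sg _ _ E) | rewrite andbT addn0].
Qed.

Lemma cut_value_subrel g1 g2 S : subrel g1 g2 -> cut_value g1 S <= cut_value g2 S.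
Proof. by move=> sg; rewrite !cut_valueE edges_subrel. Qed.

Lemma cut_valueC g S : symmetric g -> cut_value g (~: S) = cut_value g S.
Proof. by move=> gs; rewrite !cut_valueE setCK edges_sym. Qed.

(** An edge between [A] and [B] counts in both cuts on the left and not in the cut of the union.
    Hence three queries determine [edges g A B]. *)
Lemma cut_value_disjoint g A B : symmetric g -> [disjoint A & B] ->
  cut_value g A + cut_value g B = cut_value g (A :|: B) + 2 * edges g A B.
Proof.
move=> gs dAB; rewrite !cut_valueE; set C := ~: (A :|: B).
have EA : ~: A = B :|: C.
  apply/setP => v; rewrite !inE; move/pred0P: dAB => /(_ v) /=.
  by case: (v \in A); case: (v \in B).
have EB : ~: B = A :|: C.
  apply/setP => v; rewrite !inE; move/pred0P: dAB => /(_ v) /=.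
  by case: (v \in A); case: (v \in B).
have dAC : [disjoint A & C].
  by apply/pred0P => v; rewrite /= !inE; case: (v \in A).
have dBC : [disjoint B & C].
  by apply/pred0P => v; rewrite /= !inE; case: (v \in B); rewrite ?orbT ?andbF.
rewrite EA EB !edgesUr // edgesUl // (edges_sym B A) //.
lia.
Qed.

Definition count_between (A B : {set 'I_n}) : prog n nat :=
  a <-- ask A; b <-- ask B; c <-- ask (A :|: B); Ret ((a + b - c)./2).

Lemma value_count_between g A B : symmetric g -> [disjoint A & B] ->
  value (cut_value g) (count_between A B) = edges g A B.
Proof.
move=> gs d; rewrite /count_between !value_bind /= cut_value_disjoint //.
by rewrite addKn mul2n doubleK.
Qed.

(** * Binary search for an edge *)

Definition prefix_set (j : nat) : {set 'I_n} := [set u : 'I_n | u < j].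

(* Binary search, in the window [lo, lo + 2 ^ t), for the vertex of B receiving
   the edge number k between A and B that does not belong to h. *)
Fixpoint search (h : rel 'I_n) (v0 : 'I_n) (A B : {set 'I_n}) (k t lo : nat) :
    prog n 'I_n :=
  if t is t'.+1 then
    x <-- count_between A (B :&: prefix_set (lo + 2 ^ t'));
    if x - edges h A (B :&: prefix_set (lo + 2 ^ t')) <= k
    then search h v0 A B k t' (lo + 2 ^ t') else search h v0 A B k t' lo
  else Ret (insubd v0 lo).

Lemma cost_search o h v0 A B k t lo : cost o (search h v0 A B k t lo) = 3 * t.
Proof.
elim: t lo => //= t IH lo; case: ifP => _; rewrite IH; lia.
Qed.

Lemma sum_prefixS (w : 'I_n -> nat) B (v : 'I_n) :
  \sum_(u in B :&: prefix_set v.+1) w u =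
  \sum_(u in B :&: prefix_set v) w u + (v \in B) * w v.
Proof.
rewrite [in LHS]big_mkcond [X in _ = X + _]big_mkcond /=.
rewrite (bigD1 v) //= [X in _ = X + _](bigD1 v) //= !inE ltnn ltnSn andbT andbF.
rewrite add0n addnC; congr (_ + _); last by case: (v \in B); rewrite ?mul1n.
apply: eq_bigr => u uv; rewrite !inE ltnS leq_eqVlt.
have -> //: (nat_of_ord u == v) = false by apply/negbTE.
Qed.

Lemma sum_prefix_out (w : 'I_n -> nat) B j : n <= j ->
  \sum_(u in B :&: prefix_set j) w u = \sum_(u in B) w u.
Proof.
move=> nj; apply: eq_bigl => u; rewrite !inE (leq_trans (ltn_ord u) nj).
by rewrite andbT.
Qed.

(** The last conjunct locates edge number [k]; for a singleton [A] it makes the result injective in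
    [k]. *)
Lemma value_search g h v0 A B k t : symmetric g -> subrel h g ->
  [disjoint A & B] -> n <= 2 ^ t ->
  let r := fun u v => g u v && ~~ h u v in
  k < edges r A B ->
  let v := value (cut_value g) (search h v0 A B k t 0) in
  [/\ v \in B, 0 < edges r A [set v] &
      edges r A (B :&: prefix_set v) <= k <
      edges r A (B :&: prefix_set v) + edges r A [set v]].
Proof.
move=> gs hg dAB nt r kr v.
pose F j := edges r A (B :&: prefix_set j).
have FS (u : 'I_n) : F u.+1 = F u + (u \in B) * edges r A [set u].
  by rewrite /F /edges sum_prefixS big_set1.
(* Loop invariant: the prefix count of unknown edges passes [k] inside the window. *)
have search_spec lo : F lo <= k < F (lo + 2 ^ t) ->
    exists2 j, F j <= k < F j.+1 &
      value (cut_value g) (search h v0 A B k t lo) = insubd v0 j.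
  elim: t lo {nt v} => [|t IH] lo; first by rewrite expn0 addn1; exists lo.
  case/andP => H1 H2; rewrite /search -/search value_bind value_count_between //; last first.
    by apply: disjointWr dAB; apply: subsetIl.
  rewrite -edges_diff // -/r -/(F _).
  case: leqP => H; apply: IH; apply/andP; split=> //.
  by rewrite -addnA addnn -mul2n -expnS.
have F0 : F 0 <= k.
  rewrite /F /edges big_pred0 // => u; by rewrite !inE andbF.
have Fn j : n <= j -> F j = edges r A B by move=> nj; rewrite /F /edges sum_prefix_out.
have [|j] := search_spec 0; first by rewrite F0 add0n Fn.
(* [F] is constant from [n] on, so [j] is a vertex and the default of [insubd] is never taken. *)
case: (ltnP j n) => [jn|nj]; last by rewrite !Fn ?(leqW nj) //; case: ltngtP.
rewrite -/v -[j]/(nat_of_ord (Ordinal jn)) FS => Fj Ev.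
have {}Ev : v = Ordinal jn by rewrite Ev; apply: val_inj; rewrite val_insubd /= jn.
move: Fj; rewrite -Ev; case: (v \in B); rewrite ?mul0n ?mul1n ?addn0; last by case: ltngtP.
move=> Fj; split=> //.
by case/andP: Fj => F1 F2; have := leq_ltn_trans F1 F2; rewrite -{1}[F v]addn0 ltn_add2l.
Qed.

End Edges.

(** * Finding a minimum cut of a contracted graph *)

Definition crosses (L : finType) (T : {set L}) (e : L * L) : bool :=
  (e.1 \in T) != (e.2 \in T).

(** The newest edge comes first, so the bound counts the edges known once [e] has been added. The
    witness [T] may differ from edge to edge. *)
Fixpoint sparse (L : finType) (D : nat) (s : seq (L * L)) : Prop :=
  if s is e :: s' then
    (exists2 T, crosses T e & count (crosses T) s <= D) /\ sparse D s'
  else True.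

Lemma sparse_filter (L : finType) D (p : pred (L * L)) s :
  sparse D s -> sparse D (filter p s).
Proof.
elim: s => //= e s IH [[T Te cT] /IH {}IH]; case: ifP => // pe /=.
split=> //; exists T => //; apply: leq_trans cT.
by rewrite leq_add2l count_filter sub_count // => x /= /andP[].
Qed.

(* Split along the cut of the most recent edge: at most D edges cross it, and
   the two sides inherit the hypothesis. *)
Lemma size_sparse (L : finType) D (s : seq (L * L)) (W : {set L}) :
  sparse D s -> W != set0 -> all (fun e => (e.1 \in W) && (e.2 \in W)) s ->
  size s + D <= D * #|W|.
Proof.
move: {2}#|W| (leqnn #|W|) => m; elim: m W s => [|m IH] W s Wm.
  by move=> _; rewrite -cards_eq0; case: #|W| Wm.
case: s => [|e s'] sp Wn0 sW.
  by rewrite add0n leq_pmulr // card_gt0.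
case: (sp) => -[T Te cT] _.
pose s := e :: s'; rewrite -/s in sp sW cT *.
pose in1 (e : L * L) := (e.1 \in T) && (e.2 \in T).
pose in2 (e : L * L) := (e.1 \notin T) && (e.2 \notin T).
have Es : size s = count (crosses T) s + size (filter in1 s) + size (filter in2 s).
  rewrite !size_filter; elim: (s) => //= x r ->; rewrite /crosses /in1 /in2.
  by case: (x.1 \in T); case: (x.2 \in T); lia.
have EW := cardsID T W.
have [n1 n2] : (W :&: T != set0) /\ (W :\: T != set0).
  move: sW Te => /=; rewrite /crosses => /andP[/andP[w1 w2] _].
  by case t1: (e.1 \in T); case t2: (e.2 \in T) => // _; split; apply/set0Pn;
    [exists e.1|exists e.2|exists e.2|exists e.1]; rewrite !inE ?t1 ?t2 ?w1 ?w2.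
have c1 : 0 < #|W :&: T| by rewrite card_gt0.
have c2 : 0 < #|W :\: T| by rewrite card_gt0.
have H1 : size (filter in1 s) + D <= D * #|W :&: T|.
  apply: IH => //; [lia | exact: sparse_filter |].
  apply/allP => x; rewrite mem_filter => /andP[/andP[t1 t2] /(allP sW) /andP[w1 w2]].
  by rewrite !inE t1 t2 w1 w2.
have H2 : size (filter in2 s) + D <= D * #|W :\: T|.
  apply: IH => //; [lia | exact: sparse_filter |].
  apply/allP => x; rewrite mem_filter => /andP[/andP[t1 t2] /(allP sW) /andP[w1 w2]].
  by rewrite !inE t1 t2 w1 w2.
(* At most [D] edges cross, and the two sides hold at most [D * #|W :&: T| - D] and
   [D * #|W :\: T| - D]. *)
rewrite -EW mulnDr Es; lia.
Qed.

Section Discover.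
Variable n : nat.
Implicit Types (g : rel 'I_n) (S : {set 'I_n}) (s : seq ('I_n * 'I_n)).

Definition rel_of s : rel 'I_n := fun u v => ((u, v) \in s) || ((v, u) \in s).

Lemma cut_value_rel_of_nil S : cut_value (rel_of [::]) S = 0.
Proof. by apply/eqP; rewrite cards_eq0; apply/eqP/setP => e; rewrite !inE. Qed.

(** As the edge is new in both orientations, exactly one of the ordered pairs [(a, b)], [(b, a)] is
    added to each cut that it crosses. *)
Lemma cut_value_rel_of_cons s a b S : ~~ rel_of s a b ->
  cut_value (rel_of ((a, b) :: s)) S = crosses S (a, b) + cut_value (rel_of s) S.
Proof.
move=> nab; rewrite /cut_value /crosses /=.
have [nab1 nab2] : (a, b) \notin s /\ (b, a) \notin s by apply/andP; rewrite -negb_or.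
case aS: (a \in S); case bS: (b \in S); rewrite /= ?add0n.
- apply: eq_card => -[u v]; rewrite !inE /=.
  have [[-> ->]|/eqP/negbTE E1] := (u, v) =P (a, b); first by rewrite aS bS !andbF.
  have [[-> ->]|/eqP/negbTE E2] := (v, u) =P (a, b); first by rewrite aS bS !andbF.
  by rewrite /rel_of !inE E1 E2.
- rewrite (cardsD1 (a, b)) !inE /= aS bS {1}/rel_of !inE eqxx; congr (_ + _).
  apply: eq_card => -[u v]; rewrite !inE /=.
  have [[-> ->]|/eqP/negbTE E1] := (u, v) =P (a, b); first by rewrite (negbTE nab).
  have [[-> ->]|/eqP/negbTE E2] := (v, u) =P (a, b); first by rewrite aS bS !andbF.
  by rewrite /rel_of !inE E1 E2.
- rewrite (cardsD1 (b, a)) !inE /= aS bS {1}/rel_of !inE eqxx orbT; congr (_ + _).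
  apply: eq_card => -[u v]; rewrite !inE /=.
  have [[-> ->]|/eqP/negbTE E1] := (u, v) =P (b, a).
    by rewrite /rel_of (negbTE nab1) (negbTE nab2).
  have [[-> ->]|/eqP/negbTE E2] := (u, v) =P (a, b); first by rewrite aS bS !andbF.
  have E3 : ((v, u) == (a, b)) = false by move: E1; rewrite !xpair_eqE andbC.
  by rewrite /rel_of !inE E2 E3.
- apply: eq_card => -[u v]; rewrite !inE /=.
  have [[-> ->]|/eqP/negbTE E1] := (u, v) =P (a, b); first by rewrite aS bS !andbF.
  have [[-> ->]|/eqP/negbTE E2] := (v, u) =P (a, b); first by rewrite aS bS !andbF.
  by rewrite /rel_of !inE E1 E2.
Qed.

(** These are the cuts of the graph contracted along the fibres of [lab]. *)
Definition separating (lab : 'I_n -> 'I_n) S : bool :=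
  [&& S != set0, S != setT & [exists T : {set 'I_n}, S == lab @^-1: T]].

Definition lightest (lab : 'I_n -> 'I_n) s S : bool :=
  separating lab S &&
  [forall S' : {set 'I_n}, separating lab S' ==>
     (cut_value (rel_of s) S <= cut_value (rel_of s) S')].

(* Either the lightest known cut is certified by one query, or the query
   reveals an unknown edge across it. *)
Fixpoint discover (lab : 'I_n -> 'I_n) (D : nat) (v0 : 'I_n) (t fuel : nat) s :
    prog n {set 'I_n} :=
  if fuel is fuel'.+1 then
    if [pick X | lightest lab s X] is Some X then
      if D <= cut_value (rel_of s) X then Ret set0 else
      c <-- ask X;
      if c == cut_value (rel_of s) X then Ret X else
      b <-- search (rel_of s) v0 X (~: X) 0 t 0;
      a <-- search (rel_of s) v0 [set b] X 0 t 0;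
      discover lab D v0 t fuel' ((a, b) :: s)
    else Ret set0
  else Ret set0.

Lemma cost_discover o lab D v0 t fuel s :
  cost o (discover lab D v0 t fuel s) <= fuel * (6 * t + 1).
Proof.
elim: fuel s => //= fuel IH s; case: pickP => [S _|//].
case: ifP => //= _; case: ifP => /= _; first lia.
rewrite !cost_bind !cost_search mulSn.
have := IH ((value o (search (rel_of s) v0
   [set value o (search (rel_of s) v0 S (~: S) 0 t 0)] S 0 t 0),
   value o (search (rel_of s) v0 S (~: S) 0 t 0)) :: s).
lia.
Qed.

Lemma value_discover g lab D v0 t B S0 fuel s :
  simple_graph g -> n <= 2 ^ t ->
  #|lab @: setT| <= B -> separating lab S0 -> cut_value g S0 < D ->
  subrel (rel_of s) g ->
  (forall S, cut_value (rel_of s) S = count (crosses S) s) ->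
  sparse D [seq (lab e.1, lab e.2) | e <- s] ->
  size s + fuel = D * B ->
  let S := value (cut_value g) (discover lab D v0 t fuel s) in
  [/\ S != set0, S != setT & cut_value g S <= cut_value g S0].
Proof.
move=> [gs gi] nt cB sep0 cut0; elim: fuel s => [|fuel IH] s sg cs sp sz.
  (* Out of fuel, [s] would have [D * B] edges, but sparsity allows at most [D * B - D], and [D] is
     positive. *)
  have W0 : lab @: [set: 'I_n] != set0.
    by apply/set0Pn; exists (lab v0); apply: imset_f.
  have := size_sparse sp W0; rewrite size_map => /(_ _) H.
  have := leq_mul (leqnn D) cB; suff : size s + D <= D * #|lab @: setT| by lia.
  by apply: H; apply/allP => _ /mapP[e _ ->] /=; rewrite !imset_f.
move=> /=.
have [S|] := pickP (lightest lab s); last first.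
  move=> none; have [S sepS minS] := arg_minnP (cut_value (rel_of s)) sep0.
  have /negP[] := negbT (none S); rewrite /lightest sepS.
  by apply/forallP => S'; apply/implyP/minS.
case/andP=> sepS /forallP /(_ S0); rewrite sep0 /= => minS.
have sub0 := cut_value_subrel S0 sg.
(* The known weight of [S] is at most that of [S0], hence below [D]: the failure value [set0] is not
   returned. *)
case: leqP => [|SD]; first by lia.
have subS := cut_value_subrel S sg.
have [Sn0 SnT /existsP[T /eqP ES]] := and3P sepS.
rewrite /=; case: (cut_value g S =P cut_value _ S) => [EQ|NE]; first by split=> //=; lia.
rewrite value_bind.
have dS : [disjoint S & ~: S] by rewrite disjoints_subset setCK.
pose r u v := g u v && ~~ rel_of s u v.
have rb : 0 < edges r S (~: S).
  by rewrite /r edges_diff // -!cut_valueE; lia.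
(* The first search gives an endpoint [b] outside [S] of an unknown edge, the second a matching
   endpoint [a] inside. *)
have [] := value_search v0 gs sg dS nt rb.
set b := value _ _; rewrite inE => bS rb' _.
have dbS : [disjoint [set b] & S] by rewrite disjoints1.
have rs : symmetric r.
  by move=> u v; rewrite /r gs /rel_of; congr (_ && ~~ _); rewrite orbC.
have ra : 0 < edges r [set b] S by rewrite edges_sym.
rewrite value_bind; have [] := value_search v0 gs sg dbS nt ra.
set a := value _ _ => aS.
rewrite {1}/edges !big_set1 lt0b => /andP[gba nba] _.
have nab : ~~ rel_of s a b by rewrite /rel_of orbC.
apply: IH.
- move=> u v; rewrite /rel_of !inE !xpair_eqE => /orP[]/orP[].
  + by case/andP=> /eqP-> /eqP->; rewrite gs.
  + by move=> H; apply: sg; rewrite /rel_of H.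
  + by case/andP=> /eqP-> /eqP->.
  + by move=> H; apply: sg; rewrite /rel_of H orbT.
- by move=> S'; rewrite cut_value_rel_of_cons //= cs.
- split=> //; exists T.
    by move: aS bS; rewrite ES !inE /crosses /= => -> /negbTE ->.
  have E e : crosses T (lab e.1, lab e.2) = crosses S e by rewrite ES /crosses !inE.
  rewrite /= (E (a, b)) count_map (eq_count (a2 := crosses S)); last exact: E.
  (* Fewer than [D] known edges crossed [S] before, so at most [D] do now. *)
  by rewrite -cs; case: (crosses _ _) => //; apply: ltnW.
- by rewrite /= addSnnS.
Qed.

End Discover.

(** * Random samples *)

Lemma sum_nat_modn (d q : nat) (F : nat -> nat) :
  \sum_(0 <= i < q * d) F (i %% d) = q * \sum_(0 <= i < d) F i.
Proof.
elim: q => [|q IH]; first by rewrite big_geq.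
rewrite mulSn (@big_cat_nat _ _ _ d) ?leq_addr //= mulSn; congr (_ + _).
  by rewrite !big_nat; apply: eq_bigr => i /andP[_ id]; rewrite modn_small.
rewrite -{1}[d]add0n big_addn addKn -IH.
by apply: eq_bigr => i _; rewrite modnDr.
Qed.

Lemma card_ord_modn (d m : nat) (P : pred nat) : d %| m ->
  #|[set z : 'I_m | P (z %% d)]| * d = m * #|[set k : 'I_d | P k]|.
Proof.
case/dvdnP => q ->.
have E e (Q : pred nat) : #|[set z : 'I_e | Q z]| = \sum_(0 <= i < e) Q i.
  by rewrite big_mkord -sum1dep_card big_mkcond; apply: eq_bigr => i _; case: (Q i).
by rewrite (E _ (fun i => P (i %% d))) E (sum_nat_modn d q (fun i => P i)) mulnAC.
Qed.

Lemma sum_nat_mem (T : finType) (A : {set T}) : \sum_x (x \in A : nat) = #|A|.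
Proof.
by rewrite -sum1_card [RHS]big_mkcond; apply: eq_bigr => x _; case: (x \in A).
Qed.

(** Markov's inequality, multiplied by the number of outcomes. *)
Lemma markov_count (T : finType) (F : T -> nat) a b :
  \sum_x F x <= a -> #|[set x | b < F x]| * b <= a.
Proof.
apply: leq_trans; rewrite -sum1dep_card big_distrl /= [X in _ <= X](bigID (fun x => b < F x)) /=.
apply: leq_trans (leq_addr _ _); apply: leq_sum => x bF; rewrite mul1n; exact: ltnW.
Qed.

(** Independence of the coordinates of a uniform random function. *)
Lemma card_ffun_prod (I X : finType) (G : I -> {set X}) :
  #|[set y : {ffun I -> X} | [forall v, y v \in G v]]| = \prod_v #|G v|.
Proof.
rewrite -sum_nat_mem (eq_bigr (fun y : {ffun I -> X} => \prod_v (y v \in G v))).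
  rewrite -(bigA_distr_bigA (fun v z => z \in G v : nat)).
  by apply: eq_bigr => v _; rewrite sum_nat_mem.
move=> y _; rewrite inE; case: forallP => [yG|nG].
  by rewrite big1 // => v _; rewrite yG.
have /existsP[v nv] : [exists v, y v \notin G v].
  by rewrite -negb_forall; apply/forallP.
by rewrite (bigD1 v) //= (negbTE nv).
Qed.

Section Sampling.
Variables (I X : finType) (Z : {set X}) (M : nat).
Hypotheses (M0 : 0 < M) (MZ : M * #|Z| = #|X|).

(** [Z] has density [1/M], so a uniform [x] samples each point independently with probability
    [1/M]. *)
Definition sampled (x : {ffun I -> X}) : {set I} := [set u | x u \in Z].

Lemma sum_sampled (w : I -> nat) :
  M * \sum_(x : {ffun I -> X}) \sum_(u in sampled x) w u = #|X| ^ #|I| * \sum_u w u.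
Proof.
rewrite (eq_bigr (fun x => \sum_u (if u \in sampled x then w u else 0))); last first.
  by move=> x _; rewrite big_mkcond.
rewrite exchange_big /= !big_distrr /=; apply: eq_bigr => u _.
have -> : \sum_(x : {ffun I -> X}) (if u \in sampled x then w u else 0) =
          \sum_(x : {ffun I -> X}) \prod_v (if v == u then (x v \in Z) * w u else 1).
  apply: eq_bigr => x _; rewrite (bigD1 u) //= eqxx big1 ?muln1; last first.
    by move=> v /negbTE ->.
  by rewrite inE; case: (x u \in Z); rewrite ?mul1n.
rewrite -(bigA_distr_bigA (fun v z => if v == u then (z \in Z) * w u else 1)).
rewrite (bigD1 u) //= eqxx -big_distrl /=.
rewrite sum_nat_mem (eq_bigr (fun=> #|X|)); last first.
  by move=> v /negbTE ->; rewrite sum1_card.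
rewrite prod_nat_const !mulnA MZ mulnAC -expnS.
have -> // : #|[pred v | v != u]|.+1 = #|I|.
by rewrite (cardC1 u) prednK //; apply/card_gt0P; exists u.
Qed.

(* Chernoff's method, with the moment 2 ^ (- #|N :&: sampled x|). *)
Lemma sampled_lower_tail (N : {set I}) s theta : 2 * M * s <= #|N| ->
  #|[set x : {ffun I -> X} | #|N :&: sampled x| < theta]| * 2 ^ s
  <= 2 ^ theta * #|X| ^ #|I|.
Proof.
move=> sN; set bad := [set x | _].
(* Each factor of the moment is doubled to stay within the integers. *)
pose F (u : I) (z : X) := if (u \in N) && (z \in Z) then 1 else 2.
have prodF (x : {ffun I -> X}) : 2 ^ #|I| = (\prod_u F u (x u)) * 2 ^ #|N :&: sampled x|.
  have -> : 2 ^ #|N :&: sampled x| =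
            \prod_u (if u \in N :&: sampled x then 2 else 1).
    by rewrite -big_mkcond prod_nat_const.
  rewrite -big_split /= -[LHS]prod_nat_const; apply: eq_big => // u _.
  by rewrite /F !inE; case: ifP.
(* By independence the moment factors: a point of [N] contributes [2|X| - |Z| = (2M - 1)|Z|], any
   other [2|X|]. *)
have sumF : \sum_(x : {ffun I -> X}) \prod_u F u (x u) =
            ((2 * M).-1 * #|Z|) ^ #|N| * (2 * M * #|Z|) ^ #|~: N|.
  rewrite -(bigA_distr_bigA F) (bigID (mem N)) /=; congr (_ * _).
    rewrite (eq_bigr (fun=> (2 * M).-1 * #|Z|)) ?prod_nat_const // => u uN.
    have -> : \sum_z F u z = \sum_z ((z \in Z) + (z \notin Z) * 2).
      by apply: eq_bigr => z _; rewrite /F uN; case: (z \in Z).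
    rewrite big_split -big_distrl /=.
    have E : \sum_(z : X) (z \notin Z : nat) = #|~: Z|.
      by rewrite -sum_nat_mem; apply: eq_bigr => z _; rewrite inE.
    by rewrite E sum_nat_mem; have := cardsC Z; nia.
  rewrite (eq_bigr (fun=> 2 * M * #|Z|)); last first.
    move=> u /negbTE uN; rewrite -mulnA MZ (eq_bigr (fun=> 2)) ?sum_nat_const //.
      by rewrite mulnC.
    by move=> z _; rewrite /F uN.
  by rewrite prod_nat_const; congr (_ ^ _); apply: eq_card => u; rewrite !inE.
have H1 : #|bad| * 2 ^ #|I| <= 2 ^ theta * \sum_(x : {ffun I -> X}) \prod_u F u (x u).
  rewrite big_distrr -sum1_card big_distrl /= [X in _ <= X](bigID (mem bad)) /=.
  apply: leq_trans (leq_addr _ _); apply: leq_sum => x; rewrite inE mul1n => lt.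
  by rewrite (prodF x) mulnC leq_mul2r leq_pexp2l ?orbT // ltnW.
have H2 : 2 ^ s * (2 * M).-1 ^ #|N| <= (2 * M) ^ #|N|.
  by apply: expn_pred_decay => //; rewrite muln_gt0.
rewrite -(@leq_pmul2r (2 ^ #|I|)) ?expn_gt0 // mulnAC.
apply: leq_trans (leq_mul H1 (leqnn _)) _; rewrite sumF -!mulnA leq_mul2l; apply/orP; right.
have -> : #|X| ^ #|I| * 2 ^ #|I| = (2 * M * #|Z|) ^ #|N| * (2 * M * #|Z|) ^ #|~: N|.
  by rewrite -expnMn -expnD cardsC -MZ; congr (_ ^ _); lia.
rewrite (expnMn (2 * M).-1) (expnMn _ #|Z| #|N|).
have := leq_mul H2 (leqnn (#|Z| ^ #|N| * (2 * M * #|Z|) ^ #|~: N|)).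
by rewrite !mulnA [_ * 2 ^ s]mulnC !mulnA.
Qed.

End Sampling.

(** * Star contraction *)

Section Neighbours.
Variables (n : nat) (g : rel 'I_n).
Hypothesis simple_g : simple_graph g.
Implicit Types (S P R : {set 'I_n}) (u v : 'I_n).

Definition nbrs v : {set 'I_n} := [set u | g v u].

Definition side S v : {set 'I_n} := if v \in S then S else ~: S.

Lemma mem_side S v u : (u \in side S v) = ((u \in S) == (v \in S)).
Proof. by rewrite /side; case: (v \in S); rewrite ?inE; case: (u \in S). Qed.

Lemma edges_set1 v P : edges g [set v] P = #|nbrs v :&: P|.
Proof.
rewrite /edges -sum1_card [LHS]big_mkcond [RHS]big_mkcond /=.
by apply: eq_bigr => u _; rewrite big_set1 !inE andbC; case: (u \in P); case: (g v u).
Qed.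

Lemma nbrsD1 v R : nbrs v :&: (R :\ v) = nbrs v :&: R.
Proof. by apply/setP => u; rewrite !inE; case: eqP => [->|] //=; rewrite simple_g.2. Qed.

Lemma cut_value_set1 v : cut_value g [set v] = #|nbrs v|.
Proof.
rewrite cut_valueE edges_set1; apply: eq_card => u; rewrite !inE.
by case: eqP => [->|]; rewrite ?andbT // simple_g.2.
Qed.

Lemma cut_value_nbrs S : cut_value g S = \sum_(v in ~: S) #|nbrs v :&: S|.
Proof.
rewrite cut_valueE; apply: eq_bigr => v _; rewrite -edges_set1 /edges.
by apply: eq_bigr => u _; rewrite big_set1 simple_g.1.
Qed.

(** Every cut edge is seen from both of its ends. *)
Lemma sum_crossing S : \sum_v #|nbrs v :\: side S v| = 2 * cut_value g S.
Proof.
rewrite mul2n -addnn {1}cut_value_nbrs -(cut_valueC S simple_g.1) cut_value_nbrs setCK.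
rewrite (bigID (mem S)) /= addnC; congr (_ + _).
  apply: eq_big => [v|v /negbTE vS]; first by rewrite inE.
  by rewrite /side vS setDE setCK.
by apply: eq_bigr => v vS; rewrite /side vS setDE.
Qed.

(* Otherwise moving v across would improve the cut. *)
Lemma crossing_le_same P v : v \in P -> P != [set v] ->
  (forall T, T != set0 -> T != setT -> cut_value g P <= cut_value g T) ->
  #|nbrs v :\: P| <= #|nbrs v :&: P|.
Proof.
move=> vP Pv minP.
have Pn0 : P :\ v != set0.
  by apply: contraNneq Pv => E; rewrite -(setD1K vP) E setU0.
have PnT : P :\ v != setT by apply/eqP => /setP/(_ v); rewrite !inE eqxx.
have := minP _ Pn0 PnT.
have dv : [disjoint [set v] & P :\ v] by rewrite disjoints1 !inE eqxx.
have := cut_value_disjoint simple_g.1 dv.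
rewrite setD1K // edges_set1 cut_value_set1 -(cardsID P (nbrs v)) nbrsD1.
lia.
Qed.

(** The side of [v] is not [v] alone, since that cut has value at least [D]; so at least half of the
    neighbours of [v] lie on its side. *)
Lemma degree_le_same S D v : S != set0 -> S != setT ->
  (forall T, T != set0 -> T != setT -> cut_value g S <= cut_value g T) ->
  (forall u, D <= cut_value g [set u]) -> cut_value g S < D ->
  D <= 2 * #|nbrs v :&: side S v|.
Proof.
move=> S0 ST minS degD SD.
have E : cut_value g (side S v) = cut_value g S.
  by rewrite /side; case: ifP => // _; rewrite cut_valueC //; case: simple_g.
have := degD v; rewrite cut_value_set1 -(cardsID (side S v)).
suff : #|nbrs v :\: side S v| <= #|nbrs v :&: side S v| by lia.
apply: crossing_le_same; first by rewrite mem_side eqxx.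
  by apply/eqP => Ev; have := degD v; rewrite -Ev E leqNgt SD.
by move=> T; rewrite E; apply: minS.
Qed.

(** [v] is removed from [R] because counting needs disjoint sets. Without sampled neighbours, [v] is
    its own label. *)
Definition pick_nbr (t z : nat) R v : prog n 'I_n :=
  d <-- count_between [set v] (R :\ v);
  if d == 0 then Ret v
  else search (rel_of [::]) v [set v] (R :\ v) (z %% d) t 0.

Lemma cost_pick_nbr o t z R v : cost o (pick_nbr t z R v) <= 3 * t + 3.
Proof.
by rewrite /pick_nbr cost_bind /=; case: ifP => _ //=; rewrite ?cost_search; lia.
Qed.

Section PickCount.
Variables (t : nat) (R : {set 'I_n}) (v : 'I_n).
Hypothesis nt : n <= 2 ^ t.
Let d := #|nbrs v :&: R|.
Let found k := value (cut_value g) (search (rel_of [::]) v [set v] (R :\ v) k t 0).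

Lemma value_pick_nbr z : 0 < d ->
  value (cut_value g) (pick_nbr t z R v) = found (z %% d).
Proof.
move=> d0; rewrite /pick_nbr value_bind value_count_between ?disjoints1 ?inE ?eqxx //.
  by rewrite edges_set1 nbrsD1 -/d eqn0Ngt d0.
by case: simple_g.
Qed.

(** The second part recovers [k] as the number of sampled neighbours before [found k], which makes
    [found] injective. *)
Lemma found_spec k : k < d ->
  found k \in nbrs v :&: R /\
  k = edges g [set v] ((R :\ v) :&: prefix_set n (found k)).
Proof.
move=> kd; have [gs gi] := simple_g.
have sub : subrel (rel_of [::]) g by [].
have dv : [disjoint [set v] & R :\ v] by rewrite disjoints1 !inE eqxx.
pose r x y := g x y && ~~ rel_of [::] x y.
have Er A B : edges r A B = edges g A B.
  by apply: eq_bigr => y _; apply: eq_bigr => x _; rewrite /r andbT.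
have kr : k < edges r [set v] (R :\ v) by rewrite Er edges_set1 nbrsD1.
have [] := value_search v gs sub dv nt kr.
rewrite -/(found k) -/r !Er => uR.
rewrite {1 4}/edges !big_set1 => gvu /andP[l1 l2].
have {}gvu : g v (found k) by move: gvu; case: (g _ _).
split; first by move: uR; rewrite !inE gvu => /andP[].
by move: l1 l2; rewrite gvu; lia.
Qed.

(** Indices leading outside [P] inject into the sampled neighbours outside [P], which bounds the
    misses. *)
Lemma card_pick_nbr m P : 0 < d -> d %| m ->
  m * #|nbrs v :&: R :&: P| <=
  #|[set z : 'I_m | value (cut_value g) (pick_nbr t z R v) \in P]| * d.
Proof.
move=> d0 dm.
under eq_finset => z do rewrite value_pick_nbr //.
rewrite (card_ord_modn (fun k => found k \in P)) // leq_mul2l; apply/orP; right.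
set K := [set k : 'I_d | _].
have inj : {in ~: K &, injective (fun k : 'I_d => found k)}.
  move=> k k' _ _ E; apply: val_inj => /=.
  by rewrite (found_spec (ltn_ord k)).2 (found_spec (ltn_ord k')).2 E.
have : #|~: K| <= #|nbrs v :&: R :\: P|.
  rewrite -(card_in_imset inj); apply/subset_leq_card/subsetP => u /imsetP[k].
  rewrite !inE => kP ->; rewrite kP.
  by have [] := found_spec (ltn_ord k); rewrite !inE.
by have := cardsID P (nbrs v :&: R); rewrite -/d; have := cardsC K; rewrite card_ord; lia.
Qed.

End PickCount.

(** The choices are independent, and by Bernoulli [1 + c_v / s_v <= (1 + 1/theta) ^ c_v]. The
    product over [v] has exponent at most [N * h], so it is at most [2 ^ N]. *)
Lemma card_star_contraction t m R S N h theta :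
  n <= 2 ^ t -> (forall d, 0 < d -> d <= n -> d %| m) ->
  0 < theta -> 2 * h <= theta.+1 ->
  (forall v, theta <= #|nbrs v :&: R :&: side S v|) ->
  \sum_v #|nbrs v :&: R :\: side S v| <= N * h ->
  m ^ n <= 2 ^ N *
   #|[set y : {ffun 'I_n -> 'I_m} | [forall v,
        value (cut_value g) (pick_nbr t (y v) R v) \in side S v]]|.
Proof.
move=> nt dm th0 hth same cross.
pose G v := [set z : 'I_m | value (cut_value g) (pick_nbr t z R v) \in side S v].
have -> : [set y : {ffun 'I_n -> 'I_m} | [forall v,
        value (cut_value g) (pick_nbr t (y v) R v) \in side S v]] =
   [set y : {ffun 'I_n -> 'I_m} | [forall v, y v \in G v]].
  by apply/setP => y; rewrite !inE; apply: eq_forallb => v; rewrite inE.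
rewrite card_ffun_prod.
pose sm v := #|nbrs v :&: R :&: side S v|; pose cr v := #|nbrs v :&: R :\: side S v|.
have dE v : #|nbrs v :&: R| = sm v + cr v by rewrite cardsID.
have H1 : m ^ n * \prod_v sm v <= \prod_v #|G v| * \prod_v (sm v + cr v).
  rewrite -{1}(card_ord n) -prod_nat_const -!big_split /=.
  apply: leq_prod => v _; rewrite -dE; apply: card_pick_nbr => //.
    by rewrite dE; apply: leq_trans (leq_addr _ _); apply: leq_trans (same v).
  apply: dm; last by rewrite -[X in _ <= X]card_ord max_card.
  by rewrite dE; apply: leq_trans (leq_addr _ _); apply: leq_trans (same v).
have H2 : \prod_v (sm v + cr v) * theta ^ (\sum_v cr v)
          <= \prod_v sm v * theta.+1 ^ (\sum_v cr v).
  rewrite !expn_sum -!big_split /=; apply: leq_prod => v _.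
  exact: expn_bernoulli (same v).
have H3 : theta.+1 ^ (\sum_v cr v) <= 2 ^ N * theta ^ (\sum_v cr v).
  exact: expnS_le_expn2 hth cross.
have th1 : 0 < theta ^ (\sum_v cr v) by rewrite expn_gt0 th0.
have sm0 : 0 < \prod_v sm v.
  by apply: prodn_gt0 => v; apply: leq_trans (same v).
have H4 : \prod_v (sm v + cr v) <= \prod_v sm v * 2 ^ N.
  rewrite -(leq_pmul2r th1) -mulnA; apply: leq_trans H2 _.
  by rewrite leq_mul2l H3 orbT.
rewrite -(leq_pmul2r sm0); apply: leq_trans H1 _.
rewrite mulnC -mulnA (mulnC (\prod_v #|G v|)) mulnA (mulnC (2 ^ N)).
by rewrite leq_mul2r H4 orbT.
Qed.

End Neighbours.

(** * The algorithm *)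

Definition lg (n : nat) : nat := (trunc_log 2 n).+1.

Lemma ltn_lg n : n < 2 ^ lg n.
Proof. exact: trunc_log_ltn. Qed.

(* A number uniform below n! is uniform modulo every d <= n. *)
Definition seed (n : nat) : finType := {ffun 'I_n -> 'I_(n`!)}.

Section Algorithm.
Variable n : nat.
Let h := lg n + 2.

(* The sampling probability is the inverse of the rate. *)
Definition rate (D : nat) : nat := D %/ (16 * h).

Definition multiples (M : nat) : {set 'I_(n`!)} := [set z : 'I_(n`!) | z %% M == 0].

Definition sample (D : nat) (x : seed n) : {set 'I_n} :=
  sampled (multiples (rate D)) x.

(** For logarithmic [D] nothing is contracted: the search then finds at most [D * n], that is
    [O(n log n)], edges. *)
Definition label (D : nat) (w : seed n * seed n) : prog n ('I_n -> 'I_n) :=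
  if D < 16 * h then Ret id else
  tabulate id
    (fun v => pick_nbr (lg n) (w.2 v) (sample D w.1) v)
    (enum 'I_n).

(** The labels are sampled vertices; the 4 comes from Markov's inequality for the sample size. *)
Definition classes (D : nat) : nat := if D < 16 * h then n else 4 * n %/ rate D.

Definition attempt (D : nat) (v0 : 'I_n) (w : seed n * seed n) : prog n {set 'I_n} :=
  lab <-- label D w; discover lab D v0 (lg n) (D * classes D) [::].

(** A bad seed may yield a poor or improper set, so each result is checked and its value queried. *)
Fixpoint improve (D : nat) (v0 : 'I_n) (ws : seq (seed n * seed n))
    (best : {set 'I_n} * nat) : prog n ({set 'I_n} * nat) :=
  if ws is w :: ws' then
    T <-- attempt D v0 w; c <-- ask T;
    improve D v0 ws'
      (if [&& T != set0, T != setT & c < best.2] then (T, c) else best)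
  else Ret best.

Definition min_cut_prog (ws : seq (seed n * seed n)) : prog n {set 'I_n} :=
  deg <-- tabulate (fun=> 0) (fun v => ask [set v]) (enum 'I_n);
  if [pick v | [forall u, deg v <= deg u]] is Some v then
    best <-- improve (deg v) v ws ([set v], deg v); Ret best.1
  else Ret set0.

Lemma rate_gt0 D : 16 * h <= D -> 0 < rate D.
Proof. by move=> hD; rewrite divn_gt0. Qed.

Lemma rate_le D : 16 * h * rate D <= D.
Proof. by rewrite mulnC leq_trunc_div. Qed.

Lemma le_rate D : 16 * h <= D -> D <= 32 * h * rate D.
Proof.
move=> hD; have := rate_gt0 hD; have := @ltn_ceil D (16 * h) isT.
by rewrite -/(rate D); nia.
Qed.

Lemma classes_le D : D * classes D <= 128 * h * n.
Proof.
rewrite /classes; case: ltnP => hD; first by nia.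
have H := leq_trunc_div (4 * n) (rate D).
have := leq_mul (le_rate hD) (leqnn (4 * n %/ rate D)); nia.
Qed.

Lemma cost_attempt o D v0 w :
  cost o (attempt D v0 w) <= n * (3 * lg n + 3) + 128 * h * n * (6 * lg n + 1).
Proof.
rewrite /attempt cost_bind; apply: leq_add.
  rewrite /label; case: ifP => // _.
  apply: leq_trans (cost_tabulate _ _ _) _; last by rewrite size_enum_ord.
  by move=> u; apply: cost_pick_nbr.
apply: leq_trans (cost_discover _ _ _ _ _ _ _) _.
by rewrite leq_mul2r classes_le orbT.
Qed.

Lemma cost_improve o D v0 ws best c :
  (forall w, cost o (attempt D v0 w) <= c) ->
  cost o (improve D v0 ws best) <= size ws * c.+1.
Proof.
move=> Hc; elim: ws best => //= w ws IH best.
rewrite cost_bind /= mulSn.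
set b := (if _ then _ else _); have := IH b; have := Hc w.
by move: (cost o _) (cost o _) => p q; lia.
Qed.

Lemma cost_min_cut_prog o ws :
  cost o (min_cut_prog ws) <=
  n + size ws * (n * (3 * lg n + 3) + 128 * h * n * (6 * lg n + 1)).+1.
Proof.
rewrite /min_cut_prog cost_bind; apply: leq_add.
  by apply: leq_trans (cost_tabulate _ _ (c := 1) _) _; rewrite // size_enum_ord muln1.
case: pickP => [v _|//]; rewrite cost_bind addn0; apply: cost_improve => w.
exact: cost_attempt.
Qed.

Section Correctness.
Variable g : rel 'I_n.
Hypothesis simple_g : simple_graph g.
Let o := cut_value g.

Lemma value_improve D v0 ws best :
  best.1 != set0 -> best.1 != setT -> best.2 = o best.1 ->
  let r := value o (improve D v0 ws best) in
  [/\ r.1 != set0, r.1 != setT, r.2 = o r.1, r.2 <= best.2 &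
      forall w, w \in ws -> let T := value o (attempt D v0 w) in
        T != set0 -> T != setT -> r.2 <= o T].
Proof.
elim: ws best => [|w ws IH] best b0 bT bo //=.
rewrite value_bind /=; set T := value o (attempt D v0 w).
set b := (if _ then _ else _).
have [|||r0 rT ro rb rw] := IH b; try by rewrite /b; case: ifP => // /and3P[].
have bb : b.2 <= best.2 by rewrite /b; case: ifP => // /and3P[_ _ /ltnW].
split=> //; first exact: leq_trans bb.
move=> w'; rewrite inE => /orP[/eqP -> T0 TT|]; last exact: rw.
apply: leq_trans rb _; rewrite /b -/T T0 TT /=.
by case: ltnP.
Qed.

Definition good_seed (D : nat) (S : {set 'I_n}) (w : seed n * seed n) : bool :=
  let lab := value o (label D w) in
  (#|lab @: setT| <= classes D) && separating lab S.

Lemma value_attempt D v0 w S : good_seed D S w -> o S < D ->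
  let T := value o (attempt D v0 w) in
  [/\ T != set0, T != setT & o T <= o S].
Proof.
case/andP=> cl sep SD; rewrite /attempt value_bind.
apply: (value_discover v0 simple_g (ltnW (ltn_lg n)) cl sep SD) => //.
by move=> T; rewrite cut_value_rel_of_nil.
Qed.

Lemma value_min_cut_prog ws S v1 : 1 < n -> is_global_min_cut g S ->
  (forall u, o [set v1] <= o [set u]) ->
  (o S < o [set v1] -> has (good_seed (o [set v1]) S) ws) ->
  is_global_min_cut g (value o (min_cut_prog ws)).
Proof.
move=> n1 /and3P[S0 ST /forallP minS] minv1 Hgood.
rewrite /min_cut_prog value_bind; set deg := value o (tabulate _ _ _).
have degE u : deg u = o [set u] by rewrite /deg value_tabulate ?mem_enum.
have set1T (v : 'I_n) : [set v] != setT.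
  by apply/eqP => E; have := cardsT 'I_n; rewrite -E cards1 card_ord; lia.
case: pickP => [v /forallP degv|none]; last first.
  have [v _ minv] := @arg_minnP _ (Ordinal n1) xpredT deg isT.
  by have /negP[] := negbT (none v); apply/forallP => u; apply: minv.
rewrite value_bind /=.
have v0 : [set v] != set0 by apply/set0Pn; exists v; rewrite inE.
have [r0 rT ro rb rw] :=
  @value_improve (deg v) v ws ([set v], deg v) v0 (set1T v) (degE v).
rewrite /is_global_min_cut r0 rT /=; apply/forallP => T; apply/implyP => pT.
apply: leq_trans (implyP (minS T) pT); rewrite -[X in X <= _]ro.
(* If no cut beats the minimum degree, the initial singleton is already optimal. *)
have [Sv|vS] := ltnP (o S) (deg v); last exact: leq_trans vS.
have Ev : o [set v1] = deg v.
  by apply/eqP; rewrite eqn_leq -{2}degE degv degE minv1.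
rewrite Ev in Hgood; have [w wws good] := hasP (Hgood Sv).
have [T0 TT TS] := value_attempt v good Sv.
exact: leq_trans (rw w wws T0 TT) TS.
Qed.

(** Double counting turns the sum into a weight on sampled vertices, whose expectation [sum_sampled]
    gives. *)
Lemma sum_sampled_crossing (R S : {set 'I_n}) :
  \sum_v #|nbrs g v :&: R :\: side S v| = \sum_(u in R) #|nbrs g u :\: side S u|.
Proof.
under eq_bigr => v _ do rewrite -sum1_card big_mkcond /=.
rewrite exchange_big [RHS]big_mkcond /=; apply: eq_bigr => u _.
case uR: (u \in R); last by rewrite big1 // => v _; rewrite !inE uR andbF andbF.
rewrite -sum1_card [RHS]big_mkcond; apply: eq_bigr => v _.
by rewrite !inE !mem_side uR andbT simple_g.1 eq_sym.
Qed.

Lemma card_multiples M : 0 < M -> M <= n -> M * #|multiples M| = #|'I_(n`!)|.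
Proof.
move=> M0 Mn; rewrite mulnC.
rewrite (card_ord_modn (fun k => k == 0)) ?dvdn_fact ?M0 // card_ord.
rewrite (_ : [set k : 'I_M | _] = [set Ordinal M0]) ?cards1 ?muln1 //.
by apply/setP => k; rewrite !inE.
Qed.

(** Each of the three conditions fails with probability at most 1/4. *)
Lemma card_good_samples D S N : is_global_min_cut g S ->
  (forall u, D <= o [set u]) -> o S < D -> 16 * h <= D -> 256 <= N ->
  #|seed n| <= 4 * #|[set x : seed n |
    [&& [forall v, 2 * h <= #|nbrs g v :&: sample D x :&: side S v|],
        \sum_v #|nbrs g v :&: sample D x :\: side S v| <= N * h &
        rate D * #|sample D x| <= 4 * n]]|.
Proof.
move=> /and3P[S0 ST /forallP minS] degD SD hD N256; pose R := sample D.
have {}minS T : T != set0 -> T != setT -> cut_value g S <= cut_value g T.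
  by move=> T0 TT; apply: (implyP (minS T)); rewrite T0 TT.
have M0 := rate_gt0 hD; set M := rate D in M0 *.
have n0 : 0 < n by case: (set0Pn _ S0) => u _; apply: leq_ltn_trans (ltn_ord u).
have Mn : M <= n.
  apply: leq_trans (@leq_pmull M (16 * h) isT) _; apply: leq_trans (rate_le D) _.
  apply: leq_trans (degD (Ordinal n0)) _; rewrite /o cut_value_set1 //.
  by rewrite -[X in _ <= X](card_ord n) max_card.
have MZ := card_multiples M0 Mn.
set good := [set x | _].
pose bad1 v := [set x : seed n | #|nbrs g v :&: side S v :&: R x| < 2 * h].
pose bad2 := [set x : seed n | N * h < \sum_v #|nbrs g v :&: R x :\: side S v|].
pose bad3 := [set x : seed n | 4 * n < M * #|R x|].
set X := #|seed n|.
have XE : X = #|'I_(n`!)| ^ #|'I_n| by rewrite /X card_ffun.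
have b1 : 4 * #|\bigcup_v bad1 v| <= X.
  have b1v v : #|bad1 v| * 2 ^ (2 * h) <= X.
    (* At least [D / 2] neighbours on the own side and [16 * h * M <= D] give [8 * h * M]; the tail
       is then [2 ^ (2h - 4h)], small enough for a union bound. *)
    have H : 2 * M * (4 * h) <= #|nbrs g v :&: side S v|.
      have := degree_le_same simple_g v S0 ST minS degD SD.
      have := rate_le D; rewrite -/M; nia.
    have := sampled_lower_tail M0 MZ (2 * h) H; rewrite -XE.
    rewrite (_ : 4 * h = 2 * h + 2 * h); last by lia.
    by rewrite expnD mulnA mulnC leq_pmul2l ?expn_gt0.
  have U : #|\bigcup_v bad1 v| <= \sum_v #|bad1 v|.
    elim/big_rec2: _ => [|v a A _ IH]; first by rewrite cards0.
    by apply: leq_trans (leq_card_setU _ _).1 _; rewrite leq_add2l.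
  have S1 : (\sum_v #|bad1 v|) * 2 ^ (2 * h) <= n * X.
    rewrite big_distrl /= (_ : n * X = \sum_(v : 'I_n) X); first exact: leq_sum.
    by rewrite sum_nat_const card_ord.
  have nl : n * 4 <= 2 ^ (2 * h).
    rewrite -[4]/(2 ^ 2); apply: leq_trans (_ : 2 ^ lg n * 2 ^ 2 <= _).
      by rewrite leq_mul2r ltnW ?orbT // ltn_lg.
    by rewrite -expnD leq_pexp2l // /h; lia.
  rewrite -(leq_pmul2l n0); apply: leq_trans S1.
  apply: leq_trans (leq_mul U nl); nia.
have b2 : 4 * #|bad2| <= X.
  (* The expectation is [2 c(S) / M <= 2 D / M <= 64 h]; Markov with a factor 4 explains 256. *)
  have E : \sum_(x : seed n) \sum_v #|nbrs g v :&: R x :\: side S v| <= 64 * h * X.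
    under eq_bigr => x _ do rewrite sum_sampled_crossing.
    rewrite -(leq_pmul2l M0) (sum_sampled MZ) -XE sum_crossing //.
    have := le_rate hD; rewrite -/M; move: SD; rewrite /o; nia.
  have h64 : 0 < 64 * h by rewrite muln_gt0 /h addn2.
  rewrite -(leq_pmul2l h64); apply: leq_trans (markov_count (N * h) E).
  rewrite -/bad2 mulnC -mulnA [X in X <= _]mulnCA leq_mul2l mulnA.
  by rewrite leq_mul2r N256 !orbT.
have b3 : 4 * #|bad3| <= X.
  have E : \sum_(x : seed n) M * #|R x| <= n * X.
    rewrite -big_distrr /=; under eq_bigr => x _ do rewrite -sum1_card.
    by rewrite (sum_sampled MZ) -XE sum1_card card_ord mulnC.
  rewrite -(leq_pmul2l n0); apply: leq_trans (markov_count (4 * n) E).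
  by rewrite -/bad3 mulnCA mulnA mulnC.
have : X <= #|good| + (#|\bigcup_v bad1 v| + #|bad2| + #|bad3|).
  rewrite /X -(cardsC good) leq_add2l.
  apply: leq_trans (_ : #|\bigcup_v bad1 v :|: bad2 :|: bad3| <= _).
    apply/subset_leq_card/subsetP => x; rewrite !inE !negb_and -!ltnNge -orbA.
    case/orP => [/forallPn[v]|->]; last by rewrite orbT.
    rewrite -ltnNge setIAC => xv; apply/orP; left; apply/bigcupP; exists v => //.
    by rewrite inE.
  apply: leq_trans (leq_card_setU _ _).1 _; rewrite leq_add2r.
  exact: (leq_card_setU _ _).1.
lia.
Qed.

(** The sample is good with probability at least 1/4, and given that, the stars respect [S] with
    probability at least [2 ^ (- N)]. *)
Lemma card_good_seed D S N : is_global_min_cut g S ->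
  (forall u, D <= o [set u]) -> o S < D -> 256 <= N ->
  #|{: seed n * seed n}| <= 2 ^ (N + 2) * #|[set w | good_seed D S w]|.
Proof.
move=> minS degD SD N256; have [S0 ST _] := and3P minS.
have [hD|hD] := ltnP D (16 * h).
  rewrite (_ : [set w | _] = setT) ?cardsT ?leq_pmull ?expn_gt0 //.
  apply/setP => w; rewrite !inE /good_seed /label /classes hD /=.
  have := max_card (mem (id @: [set: 'I_n])); rewrite card_ord => -> /=.
  rewrite /separating S0 ST; apply/existsP; exists S.
  by apply/eqP/setP => v; rewrite inE.
have := card_good_samples minS degD SD hD N256.
pose R := sample D; set good := [set x | _] => Hgood.
have M0 := rate_gt0 hD.
have th0 : 0 < 2 * h by rewrite muln_gt0 /h addn2.
set A := [set w | good_seed D S w].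
have -> : #|A| = \sum_x \sum_y ((x, y) \in A : nat).
  rewrite -sum_nat_mem (pair_bigA _ (fun x y => (x, y) \in A : nat)).
  by apply: eq_bigr => -[x y].
rewrite card_prod.
have {}Hy x : x \in good ->
    #|seed n| <= 2 ^ N * \sum_y ((x, y) \in A : nat).
  rewrite inE => /and3P[/forallP xs xc xR].
  have nt := ltnW (ltn_lg n).
  have dm d : 0 < d -> d <= n -> d %| n`! by move=> d0 dn; rewrite dvdn_fact ?d0.
  have hh : 2 * h <= (2 * h).+1 by [].
  have := card_star_contraction simple_g nt dm th0 hh xs xc.
  have -> : n`! ^ n = #|seed n| by rewrite card_ffun !card_ord.
  move/leq_trans; apply; rewrite leq_mul2l; apply/orP; right.
  rewrite -sum_nat_mem; apply: leq_sum => y _; rewrite !inE.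
  case: forallP => //= yS; rewrite lt0b /good_seed.
  set lab := value o _.
  have labE v : lab v = value o (pick_nbr (lg n) (y v) (R x) v).
    by rewrite /lab /label ltnNge hD value_tabulate ?mem_enum.
  have labR v : lab v \in R x.
    rewrite labE.
    have d0 : 0 < #|nbrs g v :&: R x|.
      apply: leq_trans th0 _; apply: leq_trans (xs v) _.
      exact/subset_leq_card/subsetIl.
    rewrite value_pick_nbr //.
    have [] := found_spec simple_g nt (ltn_pmod (y v) d0).
    by rewrite inE => /andP[].
  apply/andP; split.
    rewrite /classes ltnNge hD /= leq_divRL // mulnC; apply: leq_trans xR.
    rewrite leq_mul2l; apply/orP; right.
    by apply/subset_leq_card/subsetP => _ /imsetP[v _ ->].
  rewrite /separating S0 ST; apply/existsP; exists S; apply/eqP/setP => v.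
  have : lab v \in side S v by rewrite labE; exact: yS v.
  by rewrite mem_side inE => /eqP.
have H : #|good| * #|seed n| <= 2 ^ N * \sum_x \sum_y ((x, y) \in A : nat).
  rewrite -sum_nat_const big_distrr /= [X in _ <= X](bigID (mem good)) /=.
  by apply: leq_trans (leq_addr _ _); apply: leq_sum => x /Hy.
apply: leq_trans (leq_mul Hgood (leqnn _)) _.
by rewrite expnD [2 ^ N * _]mulnC -[2 ^ 2]/4 -!mulnA leq_mul2l H.
Qed.

End Correctness.
End Algorithm.

(** * Amplification and the seed space *)

(** All [Q * s] independent trials fail with probability at most
    [(1 - 1/Q) ^ (Q * s) <= 2 ^ (- s)]. *)
Lemma card_repeated_failure (Y : finType) (good : pred Y) (Q s : nat) :
  0 < Q -> #|Y| <= Q * #|[set y | good y]| ->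
  #|[set w : {ffun 'I_(Q * s) -> Y} | ~~ has good (codom w)]| * 2 ^ s
  <= #|{ffun 'I_(Q * s) -> Y}|.
Proof.
move=> Q0 goodQ; set T := Q * s.
pose b := #|~: [set y | good y]|.
have -> : #|[set w : {ffun 'I_T -> Y} | ~~ has good (codom w)]| = b ^ T.
  have -> : b ^ T = \prod_(t < T) b by rewrite prod_nat_const card_ord.
  rewrite -(card_ffun_prod (fun=> ~: [set y | good y])); apply: eq_card => w.
  rewrite !inE; apply/hasPn/forallP => [H t|H y /codomP[t ->]].
    by rewrite !inE; apply: H; apply: codom_f.
  by have := H t; rewrite !inE.
rewrite card_ffun card_ord.
have bQ : b * Q <= #|Y| * Q.-1.
  by have := cardsC [set y | good y]; rewrite -/b; nia.
have QT : 0 < Q ^ T by rewrite expn_gt0 Q0.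
rewrite -(leq_pmul2r QT) mulnAC -expnMn.
apply: leq_trans (_ : (#|Y| * Q.-1) ^ T * 2 ^ s <= _).
  by rewrite leq_mul2r; apply/orP; right; case: (T) => // e; rewrite leq_exp2r.
rewrite expnMn -mulnA leq_mul2l mulnC; apply/orP; right.
exact: expn_pred_decay.
Qed.

Section Decode.
Variables (W Om : finType).
Hypothesis Om0 : 0 < #|Om|.

(** Bit strings cannot in general be mapped uniformly onto [Om]; reduction modulo [#|Om|] is uniform
    up to a factor 2. *)
Definition decode (w : W) : Om :=
  enum_val (Ordinal (ltn_pmod (enum_rank w) Om0)).

(* The fibres of decode have size at most #|W| / #|Om| + 1. *)
Lemma card_decode (F : {set Om}) : #|Om| <= #|W| ->
  #|[set w | decode w \in F]| * #|Om| <= 2 * #|W| * #|F|.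
Proof.
move=> OmW; set q := #|W| %/ #|Om|.
have quot_lt (w : W) : enum_rank w %/ #|Om| < q.+1.
  by rewrite ltnS leq_div2r // ltnW.
pose f w : Om * 'I_q.+1 := (decode w, Ordinal (quot_lt w)).
have f_inj : injective f.
  move=> w w' [] /enum_val_inj[Em] Ed; apply: enum_rank_inj; apply: val_inj => /=.
  by rewrite (divn_eq (enum_rank w) #|Om|) (divn_eq (enum_rank w') #|Om|) Em Ed.
have H : #|[set w | decode w \in F]| <= #|F| * q.+1.
  have <- : #|setX F [set: 'I_q.+1]| = #|F| * q.+1 by rewrite cardsX cardsT card_ord.
  rewrite -(card_imset _ f_inj).
  apply/subset_leq_card/subsetP => p /imsetP[w]; rewrite inE => wF ->.
  by rewrite !inE wF.
have qW : q.+1 * #|Om| <= 2 * #|W|.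
  by have := leq_trunc_div #|W| #|Om|; rewrite -/q; lia.
apply: leq_trans (leq_mul H (leqnn _)) _.
by rewrite -mulnA mulnC leq_mul2r qW orbT.
Qed.

End Decode.

(** * Query and failure bounds *)

Lemma exists_min_cut n (g : rel 'I_n) : 1 < n -> exists S, is_global_min_cut g S.
Proof.
move=> n1; pose proper (T : {set 'I_n}) := (T != set0) && (T != setT).
have prop1 : proper [set Ordinal n1].
  apply/andP; split; first by apply/set0Pn; exists (Ordinal n1); rewrite inE.
  by apply/eqP => E; have := cardsT 'I_n; rewrite -E cards1 card_ord; lia.
have [S /andP[S0 ST] minS] := arg_minnP (cut_value g) prop1.
exists S; rewrite /is_global_min_cut S0 ST; apply/forallP => T.
exact/implyP/minS.
Qed.

Lemma Rdiv_INR_le_inv a b c : 0 < b -> 0 < c -> a * c <= b ->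
  Rle (Rdiv (INR a) (INR b)) (Rinv (INR c)).
Proof.
move=> b0 c0 abc.
have rb : Rlt 0 (INR b) by apply: lt_0_INR; apply/ltP.
have rc : Rlt 0 (INR c) by apply: lt_0_INR; apply/ltP.
have H : Rle (Rmult (INR a) (INR c)) (INR b) by rewrite -mult_INR; apply: le_INR; apply/leP.
apply: (Rmult_le_reg_r (Rmult (INR b) (INR c))); first exact: Rmult_lt_0_compat.
have -> : Rmult (Rdiv (INR a) (INR b)) (Rmult (INR b) (INR c)) = Rmult (INR a) (INR c).
  by field; lra.
have -> : Rmult (Rinv (INR c)) (Rmult (INR b) (INR c)) = INR b by field; lra.
by [].
Qed.

(** The successor on [lg n] pays for the factor 2 lost in [decode]. *)
Definition trials (Q n : nat) : finType :=
  {ffun 'I_(Q * (lg n).+1) -> (seed n * seed n)%type}.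

Lemma trials_gt0 Q n : 0 < #|trials Q n|.
Proof.
rewrite /trials card_ffun expn_gt0 card_prod muln_gt0 /seed card_ffun expn_gt0.
by rewrite !card_ord fact_gt0.
Qed.

(** With [#|trials Q n|] bits there are more bit strings than trial sequences, as [card_decode]
    requires. *)
Definition algorithm Q n (w : {ffun 'I_(#|trials Q n|) -> bool}) : qtree n :=
  qtree_of (min_cut_prog (codom (decode (trials_gt0 Q n) w))).

Lemma queries_algorithm Q n g w : 0 < n ->
  (run (cut_value g) (@algorithm Q n w)).2 <= (2696 * (2 * Q) + 1) * n * (lg n) ^ 3.
Proof.
move=> n0; rewrite /algorithm run_qtree_of /=.
apply: leq_trans (cost_min_cut_prog _ _) _; rewrite size_codom card_ord.
have : 0 < lg n by [].
move: (lg n) => L L0; rewrite !expnS expn0 muln1.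
(* For [L >= 1] the left side is at most [(6 + 128 * 3 * 7) * n * L^2 = 2694 * n * L^2]. *)
have H1 : n * (3 * L + 3) + 128 * (L + 2) * n * (6 * L + 1) < 2695 * n * (L * L) + 1.
  nia.
have H2 : L.+1 <= 2 * L by lia.
have H3 : n <= n * (L * (L * L)) by nia.
have H4 : Q * L.+1 * (n * (3 * L + 3) + 128 * (L + 2) * n * (6 * L + 1)).+1
   <= Q * (2 * L) * (2696 * n * (L * L)).
  apply: leq_mul; first by rewrite leq_mul2l H2 orbT.
  nia.
apply: leq_trans (leq_add H3 H4) _; move: 2696 => c.
by apply: eq_leq; lia.
Qed.

Lemma failure_algorithm Q n g : 1 < n -> 2 ^ (256 + 2) <= Q -> simple_graph g ->
  Rle (failure_prob (@algorithm Q n) g) (Rinv (INR n)).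
Proof.
move=> n1 QN simple_g; have [S minS] := exists_min_cut g n1.
have Q0 : 0 < Q by apply: leq_trans QN; rewrite expn_gt0.
pose W : finType := {ffun 'I_(#|trials Q n|) -> bool}.
have W0 : 0 < #|W| by rewrite card_ffun expn_gt0 card_bool.
have OmW : #|trials Q n| <= #|W| by rewrite [#|W|]card_ffun card_bool card_ord ltnW // ltn_expl.
apply: Rdiv_INR_le_inv => //; first exact: ltnW.
have [v1 _ /(_ _ isT) minv1] :=
  @arg_minnP _ (Ordinal n1) xpredT (fun v => cut_value g [set v]) isT.
set D := cut_value g [set v1] in minv1.
have correct w : (cut_value g S < D ->
      has (good_seed g D S) (codom (decode (trials_gt0 Q n) w))) ->
    is_global_min_cut g (run (cut_value g) (@algorithm Q n w)).1.
  by move=> H; rewrite run_qtree_of; apply: value_min_cut_prog minS minv1 H.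
have [SD|DS] := ltnP (cut_value g S) D; last first.
  rewrite (_ : [set w | _] = set0) ?cards0 //.
  apply/setP => w; rewrite !inE correct //.
  by rewrite ltnNge DS.
set F := [set w : trials Q n | ~~ has (good_seed g D S) (codom w)].
have FQ : #|F| * 2 ^ (lg n).+1 <= #|trials Q n|.
  apply: card_repeated_failure => //.
  apply: leq_trans (card_good_seed simple_g minS minv1 SD (leqnn 256)) _.
  by rewrite leq_mul2r QN orbT.
have H := card_decode (trials_gt0 Q n) F OmW.
set F1 := [set w | _] in H; set F2 := [set w | _].
have F21 : #|F2| <= #|F1|.
  apply/subset_leq_card/subsetP => w; rewrite !inE; apply: contraNN => Hw.
  exact: correct.
have Fl : #|F1| * 2 ^ lg n <= #|W|.
  rewrite -(leq_pmul2r (trials_gt0 Q n)) mulnAC.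
  apply: leq_trans (leq_mul H (leqnn _)) _.
  apply: leq_trans (leq_mul (leqnn #|W|) FQ).
  by rewrite expnS (mulnC 2) -!mulnA leq_mul2l (mulnCA 2) leqnn orbT.
apply: leq_trans Fl; apply: leq_mul => //; exact: ltnW (ltn_lg n).
Qed.

Theorem mainTheorem1 :
  exists (m : nat -> nat) (A : forall n : nat, {ffun 'I_(m n) -> bool} -> qtree n),
  exists (C k n0 : nat) (c : R),
    Rlt 0 c /\
    forall n : nat, n0 <= n ->
    forall g : rel 'I_n, simple_graph g ->
      (* Õ(n) queries, on every graph and every random seed *)
      (forall w : {ffun 'I_(m n) -> bool},
          (run (cut_value g) (A n w)).2 <= C * n * (trunc_log 2 n).+1 ^ k) /\
      (* exact global min cut with probability >= 1 - n^{-c} *)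
      Rle (failure_prob (A n) g) (Rpower (INR n) (Ropp c)).
Proof.
(* [Q] is kept abstract so that [2 ^ 258] is never evaluated in unary. *)
have [Q Qle] : exists Q, 2 ^ (256 + 2) <= Q by move: (2 ^ _) => Q; exists Q.
(* The exponent 3 collects one logarithm each from the trials, the sampling rate and the binary
   search. *)
exists (fun n => #|trials Q n|), (@algorithm Q), (2696 * (2 * Q) + 1), 3, 2, (IZR 1).
split; first lra.
move=> n n1 g simple_g; split=> [w|].
  by apply: queries_algorithm; apply: ltnW.
rewrite Rpower_Ropp Rpower_1; last by apply: lt_0_INR; apply/ltP/ltnW.
exact: failure_algorithm.
Qed.
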